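(* As formal power series in $q$ (equivalently, for all complex $q$ with $|q|<1$), $$\sum_{n,r\ge 0} \frac{q^{3n^2+6nr+6r^2}\,(q;q)_{3r}}{(q^3;q^3)_{2r}\,(q^3;q^3)_r\,(q^3;q^3)_n} = \frac{(q^7,q^8,q^{15};q^{15})_\infty}{(q^3;q^3)_\infty}.$$
   Context: Notation: $(a;q)_m=\prod_{j=0}^{m-1}(1-aq^j)$ for integers $m\ge 0$, $(a;q)_\infty=\prod_{j=0}^{\infty}(1-aq^j)$, and $(a_1,\dots,a_s;q)_\infty=(a_1;q)_\infty\cdots(a_s;q)_\infty$; the base may be replaced by any power of $q$ (e.g. $(a;q^3)_m=\prod_{j=0}^{m-1}(1-aq^{3j})$). *)

(* Defs.v *)
(* Formal power series in one variable on top of Mathematical Components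
   (with the classical layer of MathComp-Analysis for choice). *)
From HB Require Import structures.
From mathcomp Require Import all_boot all_order all_algebra.
From mathcomp Require Import all_classical.

Set Implicit Arguments.
Unset Strict Implicit.
Unset Printing Implicit Defensive.

Import GRing.Theory.
Local Open Scope ring_scope.

(* The wrapper keeps the Cauchy product apart from the pointwise product that
   the function type nat -> R carries in mathcomp.classical. *)
Record fps (R : Type) := Fps { fps_coef :> nat -> R }.
HB.instance Definition _ (R : Type) := [isNew for @fps_coef R].
HB.instance Definition _ (R : choiceType) := [Choice of fps R by <:].

Lemma fpsP (R : Type) (f g : fps R) : (forall k, f k = g k) <-> f = g.
Proof.
split=> [|->//]; case: f => f; case: g => g /= e; congr Fps.
exact: funext.
Qed.

Section Zmodule.
Variable R : comNzRingType.
Implicit Types f g : fps R.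

Definition fps_zero : fps R := Fps (fun _ => 0).
Definition fps_opp f : fps R := Fps (fun k => - f k).
Definition fps_add f g : fps R := Fps (fun k => f k + g k).

Fact fps_addA : associative fps_add.
Proof. by move=> f g h; apply/fpsP => k; rewrite /= addrA. Qed.
Fact fps_addC : commutative fps_add.
Proof. by move=> f g; apply/fpsP => k; rewrite /= addrC. Qed.
Fact fps_add0 : left_id fps_zero fps_add.
Proof. by move=> f; apply/fpsP => k; rewrite /= add0r. Qed.
Fact fps_addN : left_inverse fps_zero fps_opp fps_add.
Proof. by move=> f; apply/fpsP => k; rewrite /= addNr. Qed.

HB.instance Definition _ :=
  GRing.isZmodule.Build (fps R) fps_addA fps_addC fps_add0 fps_addN.

Lemma coef_fps0 k : (0 : fps R) k = 0. Proof. by []. Qed.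
Lemma coef_fpsN f k : (- f) k = - f k. Proof. by []. Qed.
Lemma coef_fpsD f g k : (f + g) k = f k + g k. Proof. by []. Qed.
Lemma coef_fpsB f g k : (f - g) k = f k - g k. Proof. by []. Qed.
Lemma coef_fps_sum (I : Type) (r : seq I) (P : pred I) (F : I -> fps R) k :
  (\sum_(i <- r | P i) F i) k = \sum_(i <- r | P i) F i k.
Proof. by elim/big_rec2: _ => // i x y _ <-. Qed.
End Zmodule.

Section Ring.
Variable R : comNzRingType.
Implicit Types f g : fps R.

Definition fps_one : fps R := Fps (fun k => (k == 0)%:R).
Definition fps_mul f g : fps R :=
  Fps (fun k => \sum_(i < k.+1) f i * g (k - i)%N).

Definition fps_trunc n f : {poly R} := \poly_(i < n) f i.

Lemma coef_fps_trunc n f k : (k < n)%N -> (fps_trunc n f)`_k = f k.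
Proof. by move=> kn; rewrite coef_poly kn. Qed.

Lemma fps_mul_trunc n f g k : (k < n)%N ->
  fps_mul f g k = (fps_trunc n f * fps_trunc n g)`_k.
Proof.
move=> kn; rewrite coefM; apply: eq_bigr => -[i /= ik] _.
by rewrite !coef_fps_trunc // (leq_ltn_trans _ kn) // ?leq_subr // -ltnS.
Qed.

Fact fps_mulC : commutative fps_mul.
Proof.
move=> f g; apply/fpsP => k.
by rewrite !(fps_mul_trunc _ _ (ltnSn k)) mulrC.
Qed.
Fact fps_mulA : associative fps_mul.
Proof.
move=> f g h; apply/fpsP => k.
transitivity ((fps_trunc k.+1 f * (fps_trunc k.+1 g * fps_trunc k.+1 h))`_k).
  rewrite /fps_mul coefM; apply: eq_bigr => -[i /= ik] _.
  by rewrite coef_fps_trunc // -fps_mul_trunc // ltnS leq_subr.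
rewrite mulrA /fps_mul coefM; apply: eq_bigr => -[i /= ik] _.
by rewrite coef_fps_trunc ?ltnS ?leq_subr // -fps_mul_trunc.
Qed.
Fact fps_mul1 : left_id fps_one fps_mul.
Proof.
move=> f; apply/fpsP => k.
by rewrite /= big_ord_recl /= subn0 mul1r big1 ?addr0 // => i _; rewrite mul0r.
Qed.
Fact fps_mulDl : left_distributive fps_mul +%R.
Proof.
move=> f g h; apply/fpsP => k /=.
by rewrite -big_split; apply: eq_bigr => i _; rewrite mulrDl.
Qed.
Fact fps_one_neq0 : fps_one != 0.
Proof. by apply/eqP => /fpsP/(_ 0)/eqP; rewrite /= oner_eq0. Qed.

HB.instance Definition _ := GRing.Zmodule_isComNzRing.Build (fps R)
  fps_mulA fps_mulC fps_mul1 fps_mulDl fps_one_neq0.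

Lemma coef_fps1 k : (1 : fps R) k = (k == 0)%:R. Proof. by []. Qed.
Lemma coef_fpsM f g k : (f * g) k = \sum_(i < k.+1) f i * g (k - i)%N.
Proof. by []. Qed.
Lemma coef_fpsM0 f g : (f * g) 0 = f 0 * g 0.
Proof. by rewrite coef_fpsM big_ord1. Qed.

Definition fpsX : fps R := Fps (fun k => (k == 1)%:R).

Lemma coef_fpsX k : fpsX k = (k == 1)%:R. Proof. by []. Qed.
End Ring.

Arguments fpsX {R}.

Section Inverse.
Variable R : comUnitRingType.
Implicit Types f g : fps R.

(* The first n coefficients of 1 / f. *)
Fixpoint fps_inv_seq f n : seq R :=
  if n is m.+1 then
    let s := fps_inv_seq f m in
    rcons s ((f 0)^-1 * ((m == 0)%:R - \sum_(j < m) f (m - j)%N * s`_j))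
  else [::].

Definition fps_unit : {pred fps R} := [pred f : fps R | f 0 \is a GRing.unit].
Definition fps_inv f : fps R :=
  if f \in fps_unit then Fps (fun k => (fps_inv_seq f k.+1)`_k) else f.

Lemma size_fps_inv_seq f n : size (fps_inv_seq f n) = n.
Proof. by elim: n => //= n IH; rewrite size_rcons IH. Qed.

Lemma nth_fps_inv_seq f n k : (k < n)%N ->
  (fps_inv_seq f n)`_k = (fps_inv_seq f k.+1)`_k.
Proof.
elim: n => // n IH; rewrite ltnS leq_eqVlt => /predU1P[-> //|kn].
by rewrite [fps_inv_seq f n.+1]/= nth_rcons size_fps_inv_seq kn IH.
Qed.

Fact fps_mulVx : {in fps_unit, left_inverse 1 fps_inv *%R}.
Proof.
move=> f fu; rewrite /fps_inv fu mulrC; apply/fpsP => k.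
rewrite coef_fpsM coef_fps1 big_ord_recl subn0.
rewrite [fps_coef _ k]/= nth_rcons size_fps_inv_seq ltnn eqxx mulrA divrr // mul1r.
rewrite -[RHS](subrK (\sum_(j < k) f (k - j)%N * (fps_inv_seq f k)`_j)).
congr (_ + _).
rewrite [RHS](reindex_inj rev_ord_inj); apply: eq_bigr => -[i ik] _ /=.
rewrite subKn //; congr (_ * _).
have kik : (k - i.+1 < k)%N by rewrite ltn_subrL (leq_ltn_trans _ ik).
by rewrite (nth_fps_inv_seq _ kik).
Qed.
Fact fps_unitPl f g : g * f = 1 -> fps_unit f.
Proof.
move=> /fpsP/(_ 0); rewrite coef_fpsM0 coef_fps1 mulrC => gf.
by apply/unitrPr; exists (g 0).
Qed.
Fact fps_inv_out : {in [predC fps_unit], fps_inv =1 id}.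
Proof. by move=> f; rewrite inE /= /fps_inv => /negbTE ->. Qed.

HB.instance Definition _ := GRing.ComNzRing_hasMulInverse.Build (fps R)
  fps_mulVx fps_unitPl fps_inv_out.

Lemma fps_unitE f : (f \is a GRing.unit) = (f 0 \is a GRing.unit).
Proof. by []. Qed.
End Inverse.

Section Limits.
Local Open Scope classical_set_scope.
Variable R : comNzRingType.
Implicit Types (u : nat -> fps R) (l s : fps R).

(* Convergence for the X-adic topology: every coefficient is eventually
   constant. *)
Definition fps_cvg u l :=
  forall k, exists N, forall n, (N <= n)%N -> u n k = l k.

Lemma fps_cvg_unique u l l' : fps_cvg u l -> fps_cvg u l' -> l = l'.
Proof.
move=> ul ul'; apply/fpsP => k; have [N uN] := ul k; have [N' uN'] := ul' k.
by rewrite -(uN (maxn N N')) ?leq_maxl // uN' // leq_maxr.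
Qed.

(* The limit of u when it exists, and 0 otherwise. *)
Definition fps_lim u : fps R := xget 0 [set l | fps_cvg u l].

Lemma fps_cvg_lim u l : fps_cvg u l -> fps_lim u = l.
Proof. by move=> ul; apply: xget_unique => // l' /fps_cvg_unique; apply. Qed.

(* The (possibly infinite) family F is summable, i.e. each coefficient is
   nonzero in finitely many terms only, and its sum is s. *)
Definition fps_has_sum (I : choiceType) (F : I -> fps R) s :=
  forall k, finite_set [set i | F i k != 0] /\
            s k = \sum_(i \in [set: I]) F i k.
End Limits.

Section QPochhammer.
Variable R : comNzRingType.
Implicit Types (a q : fps R).

Definition qpoch a q (m : nat) : fps R := \prod_(j < m) (1 - a * q ^+ j).

Definition qpochoo a q : fps R := fps_lim (qpoch a q).

Definition qpochoo_seq (s : seq (fps R)) q : fps R :=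
  \prod_(a <- s) qpochoo a q.

Lemma coef_fpsM_small (f g : fps R) n : (forall k, (k < n)%N -> g k = 0) ->
  forall k, (k < n)%N -> (f * g) k = 0.
Proof.
move=> g0 k kn; rewrite coef_fpsM big1 // => i _.
by rewrite g0 ?mulr0 // (leq_ltn_trans _ kn) // leq_subr.
Qed.

Lemma coef_fpsXn_small q n k : q 0 = 0 -> (k < n)%N -> (q ^+ n) k = 0.
Proof.
move=> q0; elim: n k => // n IH k kn; rewrite exprS coef_fpsM big_ord_recl q0.
rewrite mul0r add0r big1 // => i _; rewrite IH ?mulr0 //= /bump /=.
by rewrite add1n (leq_trans _ (_ : k <= n)%N) // ltn_subrL /= (leq_trans _ (ltn_ord i)).
Qed.

Lemma qpoch_cvg a q : q 0 = 0 -> fps_cvg (qpoch a q) (qpochoo a q).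
Proof.
move=> q0; set l : fps R := Fps (fun k => qpoch a q k.+1 k).
suff ul : fps_cvg (qpoch a q) l by rewrite /qpochoo (fps_cvg_lim ul).
move=> k; exists k.+1; elim=> // n IH; rewrite leq_eqVlt => /predU1P[<- //|].
rewrite ltnS => kn; rewrite -(IH kn).
have -> : qpoch a q n.+1 = qpoch a q n - qpoch a q n * a * q ^+ n.
  by rewrite /qpoch big_ord_recr /= mulrBr mulr1 mulrA.
rewrite coef_fpsB (@coef_fpsM_small _ _ n) ?subr0 // => i.
exact: coef_fpsXn_small.
Qed.
End QPochhammer.

Lemma qpoch_unit (R : comUnitRingType) (a q : fps R) m :
  a 0 = 0 -> qpoch a q m \is a GRing.unit.
Proof.
move=> a0; apply: rpred_prod => j _.
by rewrite fps_unitE coef_fpsB coef_fpsM0 a0 mul0r subr0 unitr1.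
Qed.

Lemma qpochoo_unit (R : comUnitRingType) (a q : fps R) :
  a 0 = 0 -> q 0 = 0 -> qpochoo a q \is a GRing.unit.
Proof.
move=> a0 q0; have [N aN] := qpoch_cvg a q0 0.
by rewrite fps_unitE -(aN N) // -fps_unitE qpoch_unit.
Qed.

(* Main.v *)
Require Import Defs.
From mathcomp Require Import all_boot all_order all_algebra ring zify.
From mathcomp Require Import all_classical.

Set Implicit Arguments.
Unset Strict Implicit.
Unset Printing Implicit Defensive.

Import GRing.Theory.
Local Open Scope ring_scope.

(** Write p = q^3 and collect the terms with n + r = N.  The exponent is then
    3 N^2 + 3 r^2, so the double sum is
      sum_N p^(N^2) sum_(r <= N) p^(r^2) beta_r / (p;p)_(N-r),
    with beta_r = (q;q)_(3r) / ((p;p)_(2r) (p;p)_r)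
                = (q;p)_r (q^2;p)_r / (p;p)_(2r).
    This is what two steps of the Bailey chain produce from the sequence beta,
    the second step being taken in its limiting form.

    The finite form of Jacobi's triple product identity
    ([finite_triple_product], [theta_bailey_pair]) at z = q, w = q^2 says that
    beta is the second half of a Bailey pair relative to 1 in base p whose first
    half is
      alpha_0 = 1,  alpha_k = (-1)^k p^(k(k-1)/2) (q^k + q^(2k)) for k > 0.
    A step of the chain ([bailey_lemma]) multiplies alpha_k by p^(k^2); it rests
    on a Durfee-rectangle summation ([durfee_sum]).  In the limit
    ([bailey_lemma_limit]) the double sum becomes
      (1 / (p;p)_oo) * sum_k p^(2 k^2) alpha_k.
    Since p^(2 k^2) alpha_k is the same theta term for z = q^7, w = q^8
    and base q^15 ([theta_alpha_twist]), the sum over k equals (q^7,q^8,q^15;q^15)_oo by the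
    infinite triple product ([triple_product]).

    All limits are taken coefficientwise; the interchange of limit and sum is
    [fps_cvg_tannery]. *)

(** * Limits of formal power series *)

Section Limits.
Variable R : comNzRingType.
Implicit Types (u v : nat -> fps R) (f l m : fps R).

Lemma fps_cvg_cst l : fps_cvg (fun=> l) l.
Proof. by move=> k; exists 0. Qed.

Lemma fps_cvg_ext u v l : u =1 v -> fps_cvg u l -> fps_cvg v l.
Proof. by move=> uv ul k; have [N uN] := ul k; exists N => n /uN; rewrite uv. Qed.

Lemma fps_cvgD u v l m :
  fps_cvg u l -> fps_cvg v m -> fps_cvg (fun n => u n + v n) (l + m).
Proof.
move=> ul vm k; have [N uN] := ul k; have [M vM] := vm k.
exists (maxn N M) => n; rewrite geq_max => /andP[Nn Mn].
by rewrite !coef_fpsD uN // vM.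
Qed.

Lemma fps_cvgN u l : fps_cvg u l -> fps_cvg (fun n => - u n) (- l).
Proof.
by move=> ul k; have [N uN] := ul k; exists N => n Nn; rewrite !coef_fpsN uN.
Qed.

Lemma fps_cvg_sub0 u l : fps_cvg u l -> fps_cvg (fun n => u n - l) 0.
Proof.
by move=> ul; rewrite -(subrr l); apply: fps_cvgD => //; apply: fps_cvg_cst.
Qed.

Lemma fps_sub0_cvg u l : fps_cvg (fun n => u n - l) 0 -> fps_cvg u l.
Proof.
move=> /fps_cvgD/(_ (fps_cvg_cst l)).
by rewrite add0r; apply: fps_cvg_ext => n; rewrite subrK.
Qed.

Lemma fps_cvg_close u v l :
  fps_cvg (fun n => u n - v n) 0 -> fps_cvg u l <-> fps_cvg v l.
Proof.
move=> uv; split=> [ul|vl].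
  have := fps_cvgD ul (fps_cvgN uv); rewrite oppr0 addr0.
  by apply: fps_cvg_ext => n; rewrite opprB addrC subrK.
by have := fps_cvgD uv vl; rewrite add0r; apply: fps_cvg_ext => n; rewrite subrK.
Qed.

Lemma fps_cvg0M u v : fps_cvg u 0 -> fps_cvg (fun n => u n * v n) 0.
Proof.
move=> u0 k.
have [N uN] : exists N, forall n, (N <= n)%N -> forall i, (i < k.+1)%N -> u n i = 0.
  elim: (k.+1) => [|j [N uN]]; first by exists 0.
  have [M uM] := u0 j; exists (maxn N M) => n; rewrite geq_max => /andP[Nn Mn] i.
  by rewrite ltnS leq_eqVlt => /predU1P[->|]; [exact: uM|exact: uN].
exists N => n /uN un; rewrite coef_fpsM big1 // => i _.
by rewrite un // mul0r.
Qed.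

Lemma fps_cvgM u v l m :
  fps_cvg u l -> fps_cvg v m -> fps_cvg (fun n => u n * v n) (l * m).
Proof.
move=> /fps_cvg_sub0 ul /fps_cvg_sub0 vm; apply/fps_sub0_cvg.
have := fps_cvgD (fps_cvg0M v ul) (fps_cvg0M (fun=> l) vm).
by rewrite addr0; apply: fps_cvg_ext => n; ring.
Qed.

Lemma fps_cvg_comp u l (phi : nat -> nat) :
  (forall n, n <= phi n)%N -> fps_cvg u l -> fps_cvg (u \o phi) l.
Proof.
move=> phin ul k; have [N uN] := ul k; exists N => n Nn /=.
exact/uN/(leq_trans Nn).
Qed.

Lemma fps_cvg_shift u l j : fps_cvg u l -> fps_cvg (fun n => u (n - j)%N) l.
Proof.
move=> ul k; have [N uN] := ul k; exists (N + j)%N => n Nn.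
by apply: uN; lia.
Qed.

(** The analogue of Tannery's theorem: as t j has order at least j, only the
    terms with j <= k reach the coefficient of X^k, so termwise convergence is
    enough.  Comparing two partial sums lets [fps_cvg_close] transfer convergence
    from either of them to the other. *)
Lemma fps_cvg_tannery (t : nat -> fps R) (u : nat -> nat -> fps R) l :
  (forall j k, (k < j)%N -> t j k = 0) ->
  (forall j, fps_cvg (u^~ j) l) ->
  fps_cvg (fun n => \sum_(j < n.+1) t j * u n j - l * \sum_(j < n.+1) t j) 0.
Proof.
move=> t0 ul k.
have {}ul j : fps_cvg (fun n => (u n j - l) * t j) 0.
  by apply: fps_cvg0M; apply: fps_cvg_sub0.
have /(_ k)[N uN] : fps_cvg (fun n => \sum_(j < k.+1) (u n j - l) * t j) 0.
  elim: (k.+1) => [|K IH].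
    by apply: fps_cvg_ext (fps_cvg_cst 0) => n; rewrite big_ord0.
  have := fps_cvgD IH (ul K); rewrite addr0; apply: fps_cvg_ext => n.
  by rewrite /= big_ord_recr.
exists (maxn N k) => n; rewrite geq_max => /andP[Nn kn]; rewrite -(uN n Nn).
rewrite mulr_sumr -sumrB !coef_fps_sum.
rewrite (big_ord_widen n.+1 (fun j => ((u n j - l) * t j) k)) //.
rewrite [RHS]big_mkcond; apply: eq_bigr => j _; rewrite ltnS.
rewrite (mulrC (t j)) -mulrBl; case: leqP => // kj.
apply: (@coef_fpsM_small _ _ _ k.+1) => // i.
by rewrite ltnS => ik; apply: t0; apply: leq_ltn_trans kj.
Qed.

End Limits.

Lemma fps_cvgV (R : comUnitRingType) (u : nat -> fps R) l :
  (forall n, u n \is a GRing.unit) -> l \is a GRing.unit ->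
  fps_cvg u l -> fps_cvg (fun n => (u n)^-1) l^-1.
Proof.
move=> uU lU /fps_cvgN/fps_cvgD/(_ (fps_cvg_cst l)).
rewrite addNr => ul0; have := fps_cvg0M (fun n => (u n)^-1 * l^-1) ul0.
move=> {}ul0; apply: fps_sub0_cvg; apply: fps_cvg_ext ul0 => n.
have := mulrV (uU n); have := mulrV lU.
set a := u n; set b := a^-1; set c := l^-1 => H1 H2.
ring: H1 H2.
Qed.

(** * Gaussian binomial coefficients *)

Lemma qpochS (R : comNzRingType) (a q : fps R) m :
  qpoch a q m.+1 = qpoch a q m * (1 - a * q ^+ m).
Proof. by rewrite /qpoch big_ord_recr. Qed.

Lemma qpoch0 (R : comNzRingType) (a q : fps R) : qpoch a q 0 = 1.
Proof. by rewrite /qpoch big_ord0. Qed.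

Section Gauss.
Variables (R : comUnitRingType) (p : fps R).
Hypothesis p0 : p 0 = 0.

(** The Gaussian binomial coefficient in base p; the value 0 for m < i makes
    Pascal's rule hold for all m and i. *)
Definition gauss m i : fps R :=
  if (i <= m)%N then qpoch p p m / (qpoch p p i * qpoch p p (m - i)) else 0.

Lemma qpoch_mulV i : qpoch p p i * (qpoch p p i)^-1 = 1.
Proof. by rewrite mulrV // qpoch_unit. Qed.

Lemma qpochV i :
  (qpoch p p i)^-1 = (1 - p ^+ i.+1) * (qpoch p p i.+1)^-1.
Proof.
apply: (mulrI (qpoch_unit p i p0)); rewrite mulrV ?qpoch_unit //.
by rewrite mulrA exprS -qpochS mulrV ?qpoch_unit.
Qed.

Lemma gauss_small m i : (m < i)%N -> gauss m i = 0.
Proof. by rewrite /gauss ltnNge => /negbTE ->. Qed.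

Lemma gaussn0 m : gauss m 0 = 1.
Proof. by rewrite /gauss subn0 qpoch0 mul1r qpoch_mulV. Qed.

Lemma gaussnn m : gauss m m = 1.
Proof. by rewrite /gauss leqnn subnn qpoch0 mulr1 qpoch_mulV. Qed.

Lemma gauss_sym m i : (i <= m)%N -> gauss m (m - i) = gauss m i.
Proof. by move=> im; rewrite /gauss leq_subr im subKn // [_ * qpoch _ _ i]mulrC. Qed.

Lemma gauss_pascal m i :
  gauss m.+1 i.+1 = gauss m i.+1 + p ^+ (m - i) * gauss m i.
Proof.
have [mi|im|->] := ltngtP m i.
- by rewrite (@gauss_small m.+1) ?(@gauss_small m) ?mulr0 ?addr0 // ltnS ltnW.
- rewrite /gauss ltnS im (ltnW im) subSS.
  have -> : (m - i = (m - i.+1).+1)%N by lia.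
  have ep : p ^+ m.+1 = p ^+ i.+1 * p ^+ (m - i.+1).+1.
    by rewrite -exprD; congr (_ ^+ _); lia.
  rewrite !invrM ?qpoch_unit // (qpochV i) (qpochV (m - i.+1)).
  by rewrite qpochS -exprS ep; ring.
- by rewrite !gaussnn gauss_small // subnn add0r mulr1.
Qed.

(** Sorting the partitions into at most m + c parts by the largest j such that
    a rectangle with j + c rows and j columns fits in the diagram gives this
    identity: gauss m j counts what lies below the rectangle, and the last factor
    what lies to its right.
    The proof is by induction on m: Pascal's rule splits the sum for (m + 1, c)
    into the sum for (m, c) and, after the shift j -> j + 1, p^(m+c+1) times the
    sum for (m, c + 1). *)
Lemma durfee_sum m c :
  \sum_(j < m.+1) p ^+ (j * (j + c)) * gauss m j / qpoch p p (j + c) =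
  (qpoch p p (m + c))^-1.
Proof.
elim: m c => [|m IH] c.
  by rewrite big_ord1 gaussn0 mulr1 mul1r.
rewrite big_ord_recl gaussn0.
under eq_bigr => j _ do rewrite /= /bump leq0n add1n gauss_pascal mulrDr mulrDl.
rewrite big_split /= addrA.
have -> : 1 * 1 / qpoch p p (0 + c) + \sum_(i < m.+1)
    p ^+ (i.+1 * (i.+1 + c)) * gauss m i.+1 / qpoch p p (i.+1 + c) =
  (qpoch p p (m + c))^-1.
  rewrite big_ord_recr /= gauss_small // mulr0 mul0r addr0 -IH big_ord_recl.
  by rewrite gaussn0 mul0n expr0.
have -> : \sum_(i < m.+1) p ^+ (i.+1 * (i.+1 + c)) * (p ^+ (m - i) * gauss m i)
      / qpoch p p (i.+1 + c) = p ^+ (m + c).+1 / qpoch p p (m + c).+1.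
  rewrite -addnS -IH mulr_sumr; apply: eq_bigr => -[i /= im] _.
  rewrite !mulrA -!exprD addSnnS; congr (p ^+ _ * _ / _); nia.
rewrite addSn; apply: (mulIr (qpoch_unit p (m + c).+1 p0)).
rewrite mulrDl mulVr ?qpoch_unit // mulrVK ?qpoch_unit //.
by rewrite qpochS mulrA mulVr ?qpoch_unit // mul1r -exprS subrK.
Qed.

End Gauss.

(** * The finite triple product *)

Section FiniteTripleProduct.
Variables (R : comUnitRingType).
Implicit Types z w : fps R.

(** With k = i - n in the integers and w standing for p / z, where p = z w, this
    is the theta term (-1)^k p^(k(k-1)/2) z^k.  One of the truncated differences
    i - n and n - i is zero, so that negative powers of z appear as powers
    of w. *)
Definition theta_term z w n i : fps R :=
  (-1) ^+ ((i - n) + (n - i)) * (z * w) ^+ ('C(i - n, 2) + 'C(n - i, 2))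
  * z ^+ (i - n) * w ^+ (n - i).

(** Two consecutive theta terms have the ratio - z p^k, where k = i - n may be
    negative; multiplying by p^(m - k) clears the denominator. *)
Lemma theta_termS z w m n i : (i <= m + n)%N ->
  theta_term z w n i.+1 * (z * w) ^+ (m + n - i) =
  - (z * (z * w) ^+ m) * theta_term z w n i.
Proof.
move=> imn; rewrite /theta_term; have [ni|ni] := leqP n i.
  have [k def_i] : exists k, i = (n + k)%N by exists (i - n)%N; lia.
  have [l def_m] : exists l, m = (l + k)%N by exists (m - k)%N; lia.
  have -> : (i.+1 - n = k.+1)%N by lia.
  have -> : (n - i.+1 = 0)%N by lia.
  have -> : (i - n = k)%N by lia.
  have -> : (n - i = 0)%N by lia.
  have -> : (m + n - i = l)%N by lia.
  by rewrite def_m binS bin1 !addn0 !expr0 !exprD !exprS; ring.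
have [k def_n] : exists k, n = (i + k.+1)%N by exists (n - i.+1)%N; lia.
have -> : (i.+1 - n = 0)%N by lia.
have -> : (n - i.+1 = k)%N by lia.
have -> : (i - n = 0)%N by lia.
have -> : (n - i = k.+1)%N by lia.
have -> : (m + n - i = m + k.+1)%N by lia.
by rewrite binS bin1 !add0n !expr0 !exprD !exprS; ring.
Qed.

Definition theta_sum z w m n :=
  \sum_(i < (m + n).+1) theta_term z w n i * gauss (z * w) (m + n) i.

(** Reversing the order of summation exchanges z with w and m with n; this
    reduces the factors in w to the factors in z. *)
Lemma theta_sum_sym z w m n : theta_sum z w m n = theta_sum w z n m.
Proof.
rewrite /theta_sum [(n + m)%N]addnC [LHS](reindex_inj rev_ord_inj).
apply: eq_bigr => i _; move: (ltn_ord i); rewrite [nat_of_ord (rev_ord i)]/=.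
move: (nat_of_ord i) => {}i; rewrite ltnS subSS => ile.
rewrite (gauss_sym _ ile) [z * w]mulrC; congr (_ * _).
rewrite /theta_term.
have -> : (m + n - i - n = m - i)%N by lia.
have -> : (n - (m + n - i) = i - m)%N by lia.
by rewrite [w * z]mulrC !exprD; ring.
Qed.

Section PositiveOrder.
Variables z w : fps R.
Hypothesis zw0 : (z * w) 0 = 0.

(** Pascal's rule splits off theta_sum z w m n; by [theta_termS] the remaining
    part is - z p^m times the same sum. *)
Lemma theta_sumS m n :
  theta_sum z w m.+1 n = (1 - z * (z * w) ^+ m) * theta_sum z w m n.
Proof.
have step i : (i <= m + n)%N ->
    theta_term z w n i.+1 * gauss (z * w) (m + n).+1 i.+1 =
    theta_term z w n i.+1 * gauss (z * w) (m + n) i.+1 -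
    z * (z * w) ^+ m * (theta_term z w n i * gauss (z * w) (m + n) i).
  move=> imn; rewrite gauss_pascal; last exact: zw0.
  by rewrite mulrDr [X in _ + X]mulrA (theta_termS _ _ imn) !mulNr -mulrA.
rewrite /theta_sum addSn big_ord_recl (gaussn0 zw0).
under eq_bigr => i _ do rewrite [nat_of_ord (lift _ _)]/= /bump leq0n add1n
  (step i (ltn_ord i)).
rewrite big_split /= addrA mulrBl mul1r mulr_sumr -sumrN; congr (_ + _).
rewrite big_ord_recr /= gauss_small; last exact: leqnn.
by rewrite mulr0 addr0 [RHS]big_ord_recl (gaussn0 zw0).
Qed.

Lemma theta_sum_left m n :
  theta_sum z w m n = qpoch z (z * w) m * theta_sum z w 0 n.
Proof.
elim: m => [|m IH]; first by rewrite qpoch0 mul1r.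
by rewrite theta_sumS IH qpochS; ring.
Qed.

End PositiveOrder.

Lemma finite_triple_product z w m n : (z * w) 0 = 0 ->
  theta_sum z w m n = qpoch z (z * w) m * qpoch w (z * w) n.
Proof.
move=> zw0; rewrite theta_sum_left // theta_sum_sym theta_sum_left 1?mulrC //.
rewrite [w * z]mulrC /theta_sum big_ord1 /theta_term gaussn0 ?[w * z]mulrC //.
by rewrite !expr0 !mulr1 mulrC.
Qed.

(** The theta terms of index k and -k combined. *)
Definition theta_alpha z w k : fps R :=
  if k is 0 then 1 else (-1) ^+ k * (z * w) ^+ 'C(k, 2) * (z ^+ k + w ^+ k).

End FiniteTripleProduct.

(** * Bailey pairs *)

Section Bailey.
Variables (R : comUnitRingType) (p : fps R).
Hypothesis p0 : p 0 = 0.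
Implicit Types alpha beta : nat -> fps R.

(** Bailey pairs relative to a = 1 in base p. *)
Definition bailey_pair alpha beta := forall n,
  beta n = \sum_(k < n.+1) alpha k / (qpoch p p (n - k) * qpoch p p (n + k)).

(** This is [durfee_sum] with r = k + j, m = n - k and c = 2k, because
    (k + j)^2 = k^2 + j (j + 2k). *)
Lemma bailey_kernel n k : (k <= n)%N ->
  \sum_(k <= r < n.+1) p ^+ (r ^ 2)
    / (qpoch p p (r - k) * qpoch p p (r + k) * qpoch p p (n - r)) =
  p ^+ (k ^ 2) / (qpoch p p (n - k) * qpoch p p (n + k)).
Proof.
move=> kn; rewrite -{1}[k]add0n big_addn.
have -> : (n.+1 - k = (n - k).+1)%N by lia.
have -> : (n + k = n - k + k.*2)%N by lia.
rewrite [X in _ = _ / X]mulrC.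
rewrite invrM ?qpoch_unit // mulrA mulrAC -durfee_sum // mulr_sumr mulr_suml
  big_mkord.
apply: eq_bigr => -[j /= jn] _; rewrite /gauss -ltnS jn addnK.
have -> : (j + k + k = j + k.*2)%N by lia.
have -> : (n - (j + k) = n - k - j)%N by lia.
have -> : p ^+ ((j + k) ^ 2) = p ^+ (k ^ 2) * p ^+ (j * (j + k.*2)).
  by rewrite -exprD; congr (_ ^+ _); nia.
rewrite !invrM ?unitrM ?qpoch_unit //.
have H := qpoch_mulV p0 (n - k).
rewrite -[LHS]mulr1 -H.
ring.
Qed.

(** Substitute the definition of beta, exchange the two sums, and evaluate the
    sum over r with [bailey_kernel]. *)
Lemma bailey_lemma alpha beta : bailey_pair alpha beta ->
  bailey_pair (fun k => p ^+ (k ^ 2) * alpha k)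
    (fun n => \sum_(r < n.+1) p ^+ (r ^ 2) * beta r / qpoch p p (n - r)).
Proof.
move=> ab n.
transitivity (\sum_(r < n.+1) \sum_(k < n.+1 | (k <= r)%N) alpha k * (p ^+ (r ^ 2)
    / (qpoch p p (r - k) * qpoch p p (r + k) * qpoch p p (n - r)))).
  apply: eq_bigr => -[r /= rn] _; rewrite ab mulr_sumr mulr_suml.
  rewrite (big_ord_widen n.+1 (fun k => p ^+ (r ^ 2) *
    (alpha k / (qpoch p p (r - k) * qpoch p p (r + k))) / qpoch p p (n - r))) //.
  apply: eq_big => [k|k _]; first by rewrite ltnS.
  by rewrite (invrM (x := _ * _)) ?unitrM ?qpoch_unit //; ring.
rewrite (exchange_big_dep xpredT) //=; apply: eq_bigr => -[k /= kn] _.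
rewrite -mulr_sumr mulrAC -bailey_kernel // mulrC; congr (_ * _).
by rewrite big_geq_mkord.
Qed.

End Bailey.

Lemma big_ord_center (V : nmodType) (G : nat -> V) n :
  \sum_(i < (n + n).+1) G i =
  G n + \sum_(j < n) (G (n - j.+1)%N + G (n + j.+1)%N).
Proof.
rewrite -addnS big_split_ord (reindex_inj rev_ord_inj) big_ord_recl /= addn0.
by rewrite big_split /= addrCA.
Qed.

(** * Limits of Bailey pairs and the infinite triple product *)

Section TripleProduct.
Variable R : comUnitRingType.
Implicit Types z w p : fps R.

(** The finite triple product with m = n, its terms grouped symmetrically around
    the central one, is the defining relation of a Bailey pair. *)
Lemma theta_bailey_pair z w : (z * w) 0 = 0 ->
  bailey_pair (z * w) (theta_alpha z w)
    (fun n => qpoch z (z * w) n * qpoch w (z * w) n / qpoch (z * w) (z * w) (n + n)).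
Proof.
move=> zw0 n; rewrite -(finite_triple_product _ _ zw0) /theta_sum mulr_suml.
set P := qpoch (z * w) (z * w).
pose G i := theta_term z w n i / (P i * P (n + n - i)%N).
transitivity (\sum_(i < (n + n).+1) G i).
  apply: eq_bigr => -[i /= ile] _; rewrite /gauss -ltnS ile -/P.
  have H : P (n + n)%N * (P (n + n)%N)^-1 = 1 by exact: qpoch_mulV.
  by rewrite /G -[RHS]mulr1 -H; ring.
rewrite big_ord_center [RHS]big_ord_recl; congr (_ + _).
  by rewrite /G /theta_term subnn addnK subn0 !addn0 !expr0 !mulr1.
apply: eq_bigr => -[j /= jn] _; rewrite /bump leq0n add1n /G /theta_term.
have -> : (n - j.+1 - n = 0)%N by lia.
have -> : (n - (n - j.+1) = j.+1)%N by lia.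
have -> : (n + n - (n - j.+1) = n + j.+1)%N by lia.
have -> : (n + j.+1 - n = j.+1)%N by lia.
have -> : (n - (n + j.+1) = 0)%N by lia.
have -> : (n + n - (n + j.+1) = n - j.+1)%N by lia.
rewrite [P (n + _)%N * _]mulrC -mulrDl; congr (_ / _).
by rewrite /theta_alpha !addn0 !add0n !expr0 !mulr1 -mulrDr [w ^+ _ + _]addrC.
Qed.

Section Limit.
Variable p : fps R.
Hypothesis p0 : p 0 = 0.
Local Notation P := (qpoch p p).
Local Notation E := (qpochoo p p).

Lemma qpochoo_mulV : E * E^-1 = 1.
Proof. by rewrite mulrV // qpochoo_unit. Qed.

Lemma qpochV_cvg : fps_cvg (fun n => (P n)^-1) E^-1.
Proof.
apply: fps_cvgV => [n||]; [exact: qpoch_unit|exact: qpochoo_unit|].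
exact: qpoch_cvg.
Qed.

(** In the relation defining a Bailey pair both denominators tend to
    (p;p)_oo. *)
Lemma bailey_pair_limit (alpha beta : nat -> fps R) :
  (forall j k, (k < j)%N -> alpha j k = 0) -> bailey_pair p alpha beta ->
  fps_cvg (fun n => beta n - E^-1 * E^-1 * \sum_(k < n.+1) alpha k) 0.
Proof.
move=> a0 ab.
apply: fps_cvg_ext (fps_cvg_tannery (u := fun n k => (P (n - k))^-1 * (P (n + k))^-1)
  a0 _) => [n|j].
  rewrite ab; congr (_ - _); apply: eq_bigr => k _.
  by congr (_ * _); rewrite invrM ?qpoch_unit // mulrC.
apply: fps_cvgM.
  exact: (fps_cvg_shift (u := fun n => (P n)^-1) j qpochV_cvg).
exact: (fps_cvg_comp (u := fun n => (P n)^-1) (phi := addn^~ j) (leq_addr j) qpochV_cvg).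
Qed.

Lemma coef_expfps_sqr_small (f : fps R) j k : (k < j)%N -> (p ^+ (j ^ 2) * f) k = 0.
Proof.
move=> kj; rewrite mulrC; apply: (@coef_fpsM_small _ _ _ j) => // i ij.
by apply: coef_fpsXn_small => //; nia.
Qed.

(** The pair produced by [bailey_lemma] has two asymptotic descriptions of its
    beta side: 1 / (p;p)_oo times the partial sums of p^(r^2) beta_r, by its
    definition, and 1 / (p;p)_oo^2 times those of p^(k^2) alpha_k, by
    [bailey_pair_limit]. *)
Lemma bailey_lemma_limit (alpha beta : nat -> fps R) s : bailey_pair p alpha beta ->
  fps_cvg (fun n => \sum_(k < n.+1) p ^+ (k ^ 2) * alpha k) s ->
  fps_cvg (fun n => \sum_(r < n.+1) p ^+ (r ^ 2) * beta r) (s / E).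
Proof.
move=> ab As.
have Bl := fps_cvg_tannery (u := fun n r => (P (n - r))^-1)
  (fun j => @coef_expfps_sqr_small (beta j) j)
  (fun j => fps_cvg_shift (u := fun n => (P n)^-1) j qpochV_cvg).
have Al := bailey_pair_limit (fun j => @coef_expfps_sqr_small (alpha j) j)
  (bailey_lemma p0 ab).
have /(fps_cvg_close _ Al) /(fps_cvg_close _ Bl) :=
  fps_cvgM (fps_cvg_cst (E^-1 * E^-1)) As.
move=> /(fps_cvgM (fps_cvg_cst E)).
rewrite [E * _]mulrA [E * (_ * _)]mulrA qpochoo_mulV mul1r [E^-1 * s]mulrC.
by apply: fps_cvg_ext => n; rewrite mulrA qpochoo_mulV mul1r.
Qed.

End Limit.

Lemma theta_alpha_small z w j k : z 0 = 0 -> w 0 = 0 -> (k < j)%N ->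
  theta_alpha z w j k = 0.
Proof.
move=> z0 w0; case: j => // j kj.
apply: (@coef_fpsM_small _ _ _ j.+1) => // i ij.
by rewrite coef_fpsD !coef_fpsXn_small // addr0.
Qed.

(** Because k^2 = 2 (k(k-1)/2) + k, a Gaussian factor p^(a k^2) can be absorbed
    by replacing z, w and p = z w by z p^a, w p^a and p^(2a+1). *)
Lemma theta_alpha_twist z w a k :
  theta_alpha (z * (z * w) ^+ a) (w * (z * w) ^+ a) k =
  (z * w) ^+ (a * k ^ 2) * theta_alpha z w k.
Proof.
case: k => [|k]; first by rewrite muln0 mul1r.
have -> : (k.+1 ^ 2 = 'C(k.+1, 2) + 'C(k.+1, 2) + k.+1)%N.
  by elim: k => // k IH; rewrite [in RHS]binS bin1; lia.
rewrite /theta_alpha !mulnDr !exprD !exprM; set p := z * w.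
have -> : z * p ^+ a * (w * p ^+ a) = p ^+ a * p ^+ a * p by rewrite /p; ring.
move: p (p ^+ a) ((-1) ^+ k.+1) => {}p t sgn; rewrite !exprMn.
move: ('C(k.+1, 2)) (k.+1) => c n; ring.
Qed.

(** Jacobi's triple product identity, as the limit of its finite form: the
    left-hand side of [theta_bailey_pair] tends to (z,w;p)_oo / (p;p)_oo. *)
Lemma triple_product z w p : z 0 = 0 -> w 0 = 0 -> p = z * w ->
  fps_cvg (fun n => \sum_(k < n.+1) theta_alpha z w k)
    (qpochoo z p * qpochoo w p * qpochoo p p).
Proof.
move=> z0 w0 ->; have p0 : (z * w) 0 = 0 by rewrite coef_fpsM0 z0 mul0r.
have Al := bailey_pair_limit p0 (fun j k => @theta_alpha_small z w j k z0 w0)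
  (theta_bailey_pair p0).
set E := qpochoo (z * w) (z * w).
have /(fps_cvg_close _ Al) : fps_cvg (fun n =>
    qpoch z (z * w) n * qpoch w (z * w) n / qpoch (z * w) (z * w) (n + n))
    (qpochoo z (z * w) * qpochoo w (z * w) / E).
  apply: fps_cvgM; first by apply: fps_cvgM; apply: qpoch_cvg.
  apply: fps_cvg_ext (fps_cvg_comp (phi := fun n => (n + n)%N) _ (qpochV_cvg p0)) => //.
  by move=> n; apply: leq_addr.
move=> /(fps_cvgM (fps_cvg_cst (E * E))); have H : E * E^-1 = 1 by exact: qpochoo_mulV.
have -> : E * E * (qpochoo z (z * w) * qpochoo w (z * w) / E) =
  qpochoo z (z * w) * qpochoo w (z * w) * E by ring: H.
by apply: fps_cvg_ext => n; rewrite -/E mulrA mulrACA H !mul1r.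
Qed.

End TripleProduct.

(** * The double sum *)

(** The pairs with n + r <= m carry every nonzero coefficient of degree at most
    m, so summing along antidiagonals computes the sum of the family. *)
Lemma fps_has_sum_antidiagonal (R : comNzRingType) (F : nat * nat -> fps R) s :
  (forall n r k, (k < n + r)%N -> F (n, r) k = 0) ->
  fps_cvg (fun m => \sum_(N < m.+1) \sum_(r < N.+1) F (N - r, nat_of_ord r)%N) s ->
  fps_has_sum F s.
Proof.
move=> F0 Fs k; have [m0 sm] := Fs k.
pose sq m := [seq (N - r, r)%N | N <- iota 0 m.+1, r <- iota 0 N.+1].
have sqP m n r : ((n, r) \in sq m) = (n + r <= m)%N.
  apply/allpairsPdep/idP => [[N [i []]]|nr].
    by rewrite !mem_iota => Nm iN [-> ->]; lia.
  by exists (n + r)%N, r; rewrite !mem_iota addnK; split=> //; lia.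
have uniq_sq m : uniq (sq m).
  apply: allpairs_uniq_dep => [|N _|[N r] [N' r']]; rewrite ?iota_uniq //.
  move=> /allpairsPdep[M [i [_ + ->]]] /allpairsPdep[M' [i' [_ + ->]]].
  by rewrite !mem_iota => iM iM' [NN' ii']; rewrite ii' (_ : M = M') //; lia.
split.
  apply: (@sub_finite_set _ _ [set` sq k]); last exact: finite_seq.
  move=> [n r] /= Fnr; rewrite sqP leqNgt; apply/negP => /F0 F0'.
  by rewrite F0' eqxx in Fnr.
pose m := maxn m0 k.
rewrite -(sm m) ?leq_maxl // coef_fps_sum.
rewrite -(@fsbig_widen _ _ _ _ [set` sq m]) //; last first.
  move=> [n r] [_ /=]; rewrite sqP => /negP; rewrite -ltnNge => nr.
  by apply: F0; apply: leq_ltn_trans nr; apply: leq_maxr.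
rewrite -fsbig_seq // big_allpairs_dep.
rewrite -[iota 0 m.+1]/(index_iota 0 m.+1) big_mkord; apply: eq_bigr => N _.
rewrite -[iota 0 N.+1]/(index_iota 0 N.+1) big_mkord.
by rewrite coef_fps_sum.
Qed.

Lemma qpoch_trisect (R : comNzRingType) (q : fps R) r :
  qpoch q q (3 * r) =
  qpoch q (q ^+ 3) r * qpoch (q ^+ 2) (q ^+ 3) r * qpoch (q ^+ 3) (q ^+ 3) r.
Proof.
elim: r => [|r IH]; first by rewrite !qpoch0 !mulr1.
rewrite (_ : 3 * r.+1 = (3 * r).+3)%N; last lia.
by rewrite !qpochS IH -!exprM -!exprS -!exprD !exprS; ring.
Qed.

Lemma qpochoo_seq3 (R : comNzRingType) (a b c q : fps R) :
  qpochoo_seq [:: a; b; c] q = qpochoo a q * qpochoo b q * qpochoo c q.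
Proof. by rewrite /qpochoo_seq !big_cons big_nil mulr1 mulrA. Qed.

Theorem mainTheorem3 (R : comUnitRingType) (q : fps R) (hq : q = fpsX) :
  fps_has_sum
    (fun nr : nat * nat =>
       let: (n, r) := nr in
       q ^+ (3 * n ^ 2 + 6 * n * r + 6 * r ^ 2) * qpoch q q (3 * r)
         / (qpoch (q ^+ 3) (q ^+ 3) (2 * r) * qpoch (q ^+ 3) (q ^+ 3) r
            * qpoch (q ^+ 3) (q ^+ 3) n))
    (qpochoo_seq [:: q ^+ 7; q ^+ 8; q ^+ 15] (q ^+ 15)
       / qpochoo (q ^+ 3) (q ^+ 3)).
Proof.
have q0 : q 0 = 0 by rewrite hq.
have qn0 n : (q ^+ n.+1) 0 = 0 by rewrite coef_fpsXn_small.
have p0 : (q * q ^+ 2) 0 = 0 by rewrite -exprS.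
pose beta r := qpoch q (q ^+ 3) r * qpoch (q ^+ 2) (q ^+ 3) r
  / qpoch (q ^+ 3) (q ^+ 3) (r + r).
have ab : bailey_pair (q ^+ 3) (theta_alpha q (q ^+ 2)) beta.
  by have := theta_bailey_pair p0; rewrite -exprS.
apply: fps_has_sum_antidiagonal => [n r k knr|].
  rewrite -mulrA mulrC; apply: (@coef_fpsM_small _ _ _ (n + r)) => // i inr.
  by apply: coef_fpsXn_small => //; nia.
have := triple_product (qn0 6) (qn0 7) (exprD q 7 8).
rewrite -qpochoo_seq3 => jtp.
(* Here 7 = 1 + 2 * 3 and 8 = 2 + 2 * 3: the factor p^(2 k^2) comes from the
   two steps of the chain. *)
have {}jtp : fps_cvg (fun n => \sum_(k < n.+1) (q ^+ 3) ^+ (k ^ 2) *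
    ((q ^+ 3) ^+ (k ^ 2) * theta_alpha q (q ^+ 2) k))
    (qpochoo_seq [:: q ^+ 7; q ^+ 8; q ^+ 15] (q ^+ 15)).
  apply: fps_cvg_ext jtp => n; apply: eq_bigr => k _.
  have := theta_alpha_twist q (q ^+ 2) 2 k.
  by rewrite -!exprS -!exprM -!exprD mulrA -exprD addnn -mul2n mulnCA => <-.
apply: fps_cvg_ext (bailey_lemma_limit (qn0 2) (bailey_lemma (qn0 2) ab) jtp) => m.
apply: eq_bigr => -[N /= _] _; rewrite mulr_sumr; apply: eq_bigr => -[r /= rN] _.
have [n ->] : exists n, N = (n + r)%N by exists (N - r)%N; lia.
rewrite addnK qpoch_trisect mul2n -addnn /beta.
have -> : (3 * n ^ 2 + 6 * n * r + 6 * r ^ 2 = 3 * (n + r) ^ 2 + 3 * r ^ 2)%N.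
  by rewrite sqrnD; lia.
rewrite exprD !exprM !invrM ?unitrM ?qpoch_unit //.
have H := qpoch_mulV (qn0 2) r.
by ring: H.
Qed.
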